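(* Let $n\ge1$ be an integer, $\lambda\in(0,1)$ and $\delta>0$. There exists an infinite word $w$ over a two-letter alphabet $\Sigma$ such that $$n < \mathrm{ACE}(w)\le n+\lambda \quad\text{and}\quad \mathrm{ACE}_{\mathcal{I}}(w)\ge n+1-\delta,$$ where $\mathrm{ACE}_{\mathcal{I}}$ is taken with respect to injective morphisms $\Sigma^*\to\Gamma^*$ for any finite alphabet $\Gamma$ with at least two letters.
   Context: $\mathrm{Fact}_m(w)$ is the set of length-$m$ factors of $w$. For a nonempty word $v$ and integer $p\ge0$, $v^{p/|v|}$ is the prefix of length $p$ of $vvv\cdots$. For a nonempty finite word $x$, $\mathrm{E}(x) = \sup\{ r \in \mathbb{Q} : x = v^r \text{ for some nonempty } v\}$. $\mathrm{ACE}(w) = \limsup_{m\to\infty}\sup\{\mathrm{E}(x) : x\in\mathrm{Fact}_m(w)\}$. $\mathcal{I}$ is the set of injective morphisms $\Sigma^*\to\Gamma^*$ and $\mathrm{ACE}_{\mathcal{I}}(w) = \sup\{\mathrm{ACE}(h(w)) : h\in\mathcal{I}\}$. *)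

(* Defs.v *)
From HB Require Import structures.
From mathcomp Require Import all_boot all_order all_algebra.
From mathcomp Require Import all_classical all_reals all_analysis.
Set Implicit Arguments. Unset Strict Implicit. Unset Printing Implicit Defensive.
Import Order.TTheory GRing.Theory Num.Theory.
Local Open Scope classical_set_scope.
Local Open Scope ring_scope.

Definition Fact {T : Type} (w : nat -> T) (m : nat) : set (seq T) :=
  [set x | exists i : nat, x = mkseq (fun k => w (i + k)%N) m].

(* v^{p/|v|}: the prefix of length p of v v v ... (for nonempty v). *)
Definition prefix_pow {T : Type} (v : seq T) (p : nat) : seq T :=
  take p (flatten (nseq p v)).

Definition E {R : realType} {T : Type} (x : seq T) : \bar R :=
  ereal_sup [set (ratr r)%:E | r in
    [set r : rat | exists v : seq T, (0 < size v)%N /\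
       exists p : nat, r = (p%:R / (size v)%:R)%R /\ x = prefix_pow v p]].

Definition ACE {R : realType} {T : Type} (w : nat -> T) : \bar R :=
  limn_esup (fun m : nat => ereal_sup [set (E x : \bar R) | x in Fact w m]).

(* A morphism bool^* -> G^* is determined by the images of the letters. *)
Definition morph_ext {S G : Type} (h : S -> seq G) (s : seq S) : seq G :=
  flatten (map h s).

Definition injective_morph {S G : Type} (h : S -> seq G) : Prop :=
  injective (morph_ext h).

(* h(w) for an infinite word w (letter i of h(w)); x0 is an irrelevant
   default, unused when all letter images are nonempty (e.g. h injective). *)
Definition morph_word {S G : Type} (x0 : G) (h : S -> seq G) (w : nat -> S)
  : nat -> G :=
  fun i => nth x0 (morph_ext h (mkseq w i.+1)) i.

Definition ACE_I {R : realType} {S : Type} (G : finType) (w : nat -> S)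
  : \bar R :=
  ereal_sup [set e | exists (h : S -> seq G) (x0 : G),
                       injective_morph h /\ e = ACE (morph_word x0 h w)].

(* Main.v *)
Require Import Defs.
From HB Require Import structures.
From mathcomp Require Import all_boot all_order all_algebra.
From mathcomp Require Import all_classical all_reals all_analysis.
From mathcomp Require Import zify lra.
Set Implicit Arguments. Unset Strict Implicit. Unset Printing Implicit Defensive.

(* Let u = u'u'' with |u| = K|u'|.  The word is a concatenation of powers
   u^n u' of exponent n + 1/K, whose lengths grow geometrically.  Each u is
   nonrepetitive over a large alphabet (such words exist by a counting argument
   that shows their number at least doubles with each letter), the letters of
   u' carry a mark and each power carries a parity, so every other repetition
   has exponent at most 1 + 1/K.  Letters are then coded by binary blocks of a
   fixed length q, in which the letters of u' receive many 1s and those of u''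
   exactly three; this leaves the asymptotic critical exponent unchanged.  The
   injective morphism 1 -> g1^q, 0 -> g0 makes u' much longer than u'', so the
   exponent of the image of u^n u' is close to n + 1. *)

(** The factor of length [p + l] at [i] has period [p]; [l] counts only what exceeds the first
    period, so the exponent for this period is [(p + l) / p]. *)
Definition repeats {T : Type} (w : nat -> T) (i p l : nat) : Prop :=
  forall k, k < l -> w (i + k) = w (i + p + k).

(** * Counting nonrepetitive words over a large alphabet *)

Section Counting.
Variables N k : nat.

(** Every distance [p] is [a * N + b] with [b < N], and [a + 1] is the least [l] with [N * l > p];
    forbidding this length forbids all longer ones. Words grow at the front, so only repeats of a
    prefix are tested. *)
Definition unrepeated_prefix (s : seq nat) : bool :=
  all (fun a => all (fun b =>
    [|| a * N + b == 0, size s < a * N + b + a.+1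
      | take a.+1 s != take a.+1 (drop (a * N + b) s)]) (iota 0 N))
    (iota 0 (size s)).

Fixpoint nonrep_words (m : nat) : seq (seq nat) :=
  if m is m'.+1 then
    [seq s <- [seq c :: x | c <- iota 0 k, x <- nonrep_words m']
      | unrepeated_prefix s]
  else [:: [::]].

Lemma nonrep_words_uniq m : uniq (nonrep_words m).
Proof.
elim: m => //= m IH; apply/filter_uniq/allpairs_uniq; rewrite ?iota_uniq //.
by move=> [c x] [c' x'] _ _ /= [-> ->].
Qed.

Lemma nonrep_words_size m s : s \in nonrep_words m -> size s = m.
Proof.
elim: m s => [|m IH] s /=; first by rewrite inE => /eqP ->.
by rewrite mem_filter => /andP[_ /allpairsP[[c x] /= [_ /IH <- ->]]].
Qed.

Lemma nonrep_words_letters m s : s \in nonrep_words m -> all (fun c => c < k) s.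
Proof.
elim: m s => [|m IH] s /=; first by rewrite inE => /eqP ->.
rewrite mem_filter => /andP[_ /allpairsP[[c x] /= [+ /IH xk ->]]].
by rewrite mem_iota add0n /= xk andbT.
Qed.

Lemma nonrep_words_prefix m s : s \in nonrep_words m -> unrepeated_prefix s.
Proof.
case: m => [|m] /=; first by rewrite inE => /eqP ->.
by rewrite mem_filter => /andP[].
Qed.

Lemma nonrep_words_drop m j s :
  s \in nonrep_words m -> drop j s \in nonrep_words (m - j).
Proof.
elim: j m s => [|j IH] m s; first by rewrite drop0 subn0.
case: m => [|m] /=; first by rewrite inE => /eqP ->.
rewrite mem_filter => /andP[_ /allpairsP[[c x] /= [_ xm ->]]] /=.
by rewrite subSS; apply: IH.
Qed.

(* A word whose prefix of length l recurs at distance p >= l is determined by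
   its suffix obtained by deleting that prefix. *)
Definition prepend_repeat (p l : nat) (t : seq nat) : seq nat :=
  take l (drop (p - l) t) ++ t.

(** A rejected word repeats its prefix of some length [a + 1] at one of [N] distances, so it is
    recovered from [a], [b] and its suffix of length [m - a], which is again a counted word. *)
Lemma count_unextendable m : 1 < N ->
  size [seq s <- [seq c :: x | c <- iota 0 k, x <- nonrep_words m]
         | ~~ unrepeated_prefix s]
  <= N * \sum_(0 <= a < m.+1) size (nonrep_words a).
Proof.
move=> N1.
pose L := flatten [seq flatten [seq map (prepend_repeat (a * N + b) a.+1)
  (nonrep_words (m - a)) | b <- iota 0 N] | a <- iota 0 m.+1].
have -> : N * \sum_(0 <= a < m.+1) size (nonrep_words a) = size L.
  rewrite /L size_flatten /shape -map_comp sumnE big_map.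
  rewrite -[X in iota 0 X]subn0 -/(index_iota 0 m.+1) big_nat_rev /=.
  rewrite add0n big_distrr /=.
  apply: eq_big_nat => a /andP[_ am].
  rewrite size_flatten /shape -map_comp sumnE big_map /=.
  rewrite (eq_bigr (fun=> size (nonrep_words (m - a)))) => [|b _].
    by rewrite big_const_seq count_predT size_iota iter_addn addn0 mulnC subSS.
  by rewrite size_map.
apply: uniq_leq_size.
  apply/filter_uniq/allpairs_uniq; rewrite ?iota_uniq ?nonrep_words_uniq //.
  by move=> [c x] [c' x'] _ _ /= [-> ->].
move=> s; rewrite mem_filter => /andP[+ /allpairsP[[c x] /= [_ xm sE]]].
have sz : size s = m.+1 by rewrite sE /= (nonrep_words_size xm).
case/allPn => a; rewrite mem_iota sz add0n /= => am.
case/allPn => b; rewrite mem_iota add0n /= => bN.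
rewrite !negb_or negbK -leqNgt => /and3P[p0 pm /eqP rep].
apply/flattenP; exists (flatten [seq map (prepend_repeat (a * N + b) a.+1)
  (nonrep_words (m - a)) | b <- iota 0 N]).
  by apply/mapP; exists a => //; rewrite mem_iota.
apply/flattenP; exists (map (prepend_repeat (a * N + b) a.+1)
  (nonrep_words (m - a))).
  by apply/mapP; exists b => //; rewrite mem_iota.
apply/mapP; exists (drop a.+1 s); first by rewrite sE /=; apply: nonrep_words_drop.
rewrite /prepend_repeat drop_drop subnK.
  by rewrite -rep cat_take_drop.
(* The distance is at least [a + 1]: it is nonzero if [a = 0], and [N > 1] settles the other
   case. *)
by case: (a) p0 => [|a']; nia.
Qed.

(** Doubling below [m] bounds the sum over all lengths up to [m] by twice its last term. So at most
    [2 * N] extensions per word are rejected on average, out of [k >= 2 * N + 2]. *)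
Lemma size_nonrep_words_double m : 1 < N -> 2 * N + 2 <= k ->
  2 * size (nonrep_words m) <= size (nonrep_words m.+1).
Proof.
move=> N1 kN.
have [j] := ubnP m; elim: j m => // j IH m mj.
have sumA : \sum_(0 <= a < m.+1) size (nonrep_words a) <= 2 * size (nonrep_words m).
  have : forall a, a <= m ->
      \sum_(0 <= i < a.+1) size (nonrep_words i) <= 2 * size (nonrep_words a).
    elim=> [|a IHa] am; first by rewrite big_nat1 leq_pmull.
    rewrite big_nat_recr //=.
    have := IHa (ltnW am); have := IH a (leq_trans am mj).
    by rewrite /=; lia.
  exact.
have := count_unextendable m N1.
have /= := count_predC unrepeated_prefix
  [seq c :: x | c <- iota 0 k, x <- nonrep_words m].
rewrite size_allpairs size_iota -!size_filter.
set u := size (seq.filter unrepeated_prefix _).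
set v := size (seq.filter _ _).
nia.
Qed.

Lemma unrepeated_prefixP s p l : 0 < N -> unrepeated_prefix s -> 0 < p ->
  p + l <= size s -> take l s = take l (drop p s) -> N * l <= p.
Proof.
move=> N0 /allP us p0 pl rep; rewrite leqNgt; apply/negP => lp.
have al : (p %/ N).+1 <= l by rewrite ltn_divLR // mulnC.
have ps : p %/ N \in iota 0 (size s)
  by rewrite mem_iota add0n leq0n (leq_trans al) // (leq_trans _ pl) // leq_addl.
have /allP/(_ (p %% N)) := us _ ps.
rewrite mem_iota /= add0n ltn_mod N0 => /(_ isT).
rewrite -divn_eq => /or3P[/eqP|H|/eqP[]]; try lia.
by rewrite -(take_takel s al) rep take_takel.
Qed.

End Counting.

(** One word per window length [m] is enough for the finite powers below, so no limit is taken. A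
    repeat at [i] is a prefix repeat of the suffix from [i], itself a counted word; past [m] the
    letter defaults to 0. *)
Lemma exists_nonrepetitive_word (N m : nat) : 1 < N ->
  exists X : nat -> nat, (forall i, X i < 2 * N + 2) /\
    forall i p l, 0 < p -> i + p + l <= m -> repeats X i p l -> N * l <= p.
Proof.
move=> N1; pose k := 2 * N + 2.
have : 0 < size (nonrep_words N k m).
  elim: m => // m IH.
  have := @size_nonrep_words_double N k m N1 (leqnn _); lia.
case E : nonrep_words => [|s t] // _.
have sin : s \in nonrep_words N k m by rewrite E mem_head.
have sz := nonrep_words_size sin.
exists (nth 0 s); split.
  move=> i; case: (ltnP i (size s)) => [ltis|si]; last first.
    by rewrite nth_default //; lia.
  exact: (allP (nonrep_words_letters sin)) (mem_nth 0 ltis).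
move=> i p l p0 ipl rep.
apply: (@unrepeated_prefixP N (drop i s)) => //; first lia.
    exact: nonrep_words_prefix (nonrep_words_drop i sin).
  by rewrite size_drop sz; lia.
apply: (@eq_from_nth _ 0).
  by rewrite !size_takel ?size_drop ?sz //; lia.
move=> j; rewrite size_takel ?size_drop ?sz; last lia.
move=> jl; rewrite !nth_take // !nth_drop addnA rep //.
Qed.

(** * Repeats inside a single marked power *)

Lemma modnS_cases a P : 0 < P ->
  (a.+1 %% P = (a %% P).+1 /\ (a %% P).+1 < P) \/
  (a.+1 %% P = 0 /\ (a %% P).+1 = P).
Proof.
move=> P0; have aP := ltn_pmod a P0.
rewrite -addn1 -modnDml addn1.
case: (ltngtP (a %% P).+1 P) => H; [left|lia|right].
  by rewrite modn_small.
by rewrite H modnn.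
Qed.

(* The density marker changes only at residues d - 1 and P - 1, so a repeat
   across such a change has a period divisible by P. *)
Lemma residue_run P d a p l : 0 < d < P -> ~~ (P %| p) ->
  (forall k, k < l -> ((a + k) %% P < d) = ((a + p + k) %% P < d)) ->
  forall k, k < l ->
    (a + k) %% P = a %% P + k /\ (a + p + k) %% P = (a + p) %% P + k.
Proof.
move=> /andP[d0 dP] Pp types; have P0 : 0 < P by lia.
elim=> [|k IH] kl; first by rewrite !addn0.
have [E1 E2] := IH (ltnW kl).
have T0 := types _ (ltnW kl); have := types _ kl.
have neq : (a + k) %% P <> (a + p + k) %% P.
  move=> H; case/negP: Pp; have /eqP := H.
  by rewrite -addnA [p + k]addnC addnA -[X in X == _ %[mod _]]addn0 eqn_modDl
    mod0n eq_sym.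
rewrite !addnS.
(* Only a wrap from [P - 1] to 0 turns an unmarked residue into a marked one. Equal marks thus make
   both sides wrap together, so both residues would be [P - 1], against [neq]. *)
have [[-> H1]|[-> H1]] := modnS_cases (a + k) P0;
have [[-> H2]|[-> H2]] := modnS_cases (a + p + k) P0;
move: E1 E2 T0 neq H1 H2; clear -d0 dP;
move: ((a + k) %% P) ((a + p + k) %% P) (a %% P) ((a + p) %% P) => *; lia.
Qed.

Definition marked_power (X : nat -> nat) (d P o : nat) : bool * nat :=
  (o %% P < d, X (o %% P)).

(** If [K * d] divides [p], the length of the whole power gives the bound. Otherwise each occurrence
    lies inside one copy of the period, and nonrepetitivity of [X] applies. One factor [K] of
    [K * K] is spent because the distance seen in [X] may be as large as [K * d] while [p] is only
    known to be at least [d]. *)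
Lemma marked_power_repeats (X : nat -> nat) (n K d a p l : nat) :
  0 < n -> 1 < K -> 0 < d ->
  (forall i p l, 0 < p -> i + p + l <= K * d -> repeats X i p l ->
     K * K * l <= p) ->
  0 < p -> a + p + l <= n * (K * d) + d ->
  repeats (marked_power X d (K * d)) a p l -> (p + l) * K <= (n * K + 1) * p.
Proof.
move=> n0 K1 d0 HX p0 apl rep.
have [/dvdnP[t pE]|Pp] := boolP (K * d %| p).
  have t0 : 0 < t by case: t pE p0 => // ->.
  have Pp : K * d <= p by rewrite pE leq_pmull.
  have : (p + l) * K <= (n * (K * d) + d) * K by rewrite leq_mul2r; lia.
  have : (n * K + 1) * (K * d) <= (n * K + 1) * p by rewrite leq_mul2l Pp orbT.
  nia.
suff : K * l <= p by nia.
case: (posnP l) => [->|l0]; first by rewrite muln0.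
pose P := K * d; have dP : 2 * d <= P by rewrite /P; nia.
have P0 : 0 < P by lia.
have run := @residue_run P d a p l _ Pp _.
have {}run : forall k, k < l ->
    (a + k) %% P = a %% P + k /\ (a + p + k) %% P = (a + p) %% P + k.
  by apply: run => [|k /rep []]; [lia|].
have XE k : k < l -> X (a %% P + k) = X ((a + p) %% P + k).
  by move=> kl; have [<- <-] := run k kl; have [] := rep k kl.
have types : (a %% P < d) = ((a + p) %% P < d).
  by have [] := rep 0 l0; rewrite !addn0.
have [end1 end2] : a %% P + l <= P /\ (a + p) %% P + l <= P.
  have := ltn_pmod (a + l.-1) P0; have := ltn_pmod (a + p + l.-1) P0.
  have [-> ->] := run l.-1 ltac:(clear -l0; lia).
  by rewrite -[X in _ + X <= P /\ _ + X <= _](prednK l0) !addnS.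
have neq : a %% P <> (a + p) %% P.
  move=> H; case/negP: Pp; have /eqP := H.
  by rewrite -[X in X == _ %[mod _]]addn0 eqn_modDl mod0n eq_sym.
(* With [p < d], a wrap would lead from a residue above [P - d >= d], unmarked, to one below [d],
   marked. *)
have near : p < d -> (a + p) %% P = a %% P + p.
  move=> pd; have pE : (a + p) %% P = (a %% P + p) %% P by rewrite modnDml.
  case: (ltnP (a %% P + p) P) => H; first by rewrite pE modn_small.
  have r1P := ltn_pmod a P0.
  have : (a %% P + p) %% P = a %% P + p - P.
    by rewrite -{1}(subnK H) modnDr modn_small //; clear -r1P H pd dP; lia.
  move: H r1P types; rewrite -pE; clear -pd dP.
  by move: (a %% P) ((a + p) %% P); lia.
have bound D : D <= P -> (D = p \/ d <= p) -> K * K * l <= D -> K * l <= p.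
  move=> DP Dp H; have K0 : 0 < K by exact: ltnW.
  rewrite -(leq_pmul2l K0) mulnA (leq_trans H) //.
  case: Dp => [->|dp]; first by rewrite leq_pmull.
  by rewrite (leq_trans DP) // /P leq_pmul2l.
have {}near : d <= p \/ (a + p) %% P = a %% P + p.
  by case: (leqP d p) => [|/near]; [left|right].
move: near XE end1 end2 neq; clear types run rep Pp apl.
move: (a %% P) ((a + p) %% P) => r1 r2 near XE end1 end2 neq.
case: (ltngtP r1 r2) => // lt12.
  apply: (bound (r2 - r1)); [clear -end2; lia|clear -near lt12; lia|].
  apply: (HX r1); rewrite ?subn_gt0 ?subnKC //; first exact: ltnW.
  by move=> k kl; rewrite subnKC; [exact: XE|exact: ltnW].
apply: (bound (r1 - r2)); [clear -end1; lia|clear -near lt12 p0; lia|].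
apply: (HX r2); rewrite ?subn_gt0 ?subnKC //; first exact: ltnW.
by move=> k kl; rewrite subnKC; [rewrite XE|exact: ltnW].
Qed.

(** * Concatenation of blocks of prescribed lengths *)

Section Blocks.
Variable len : nat -> nat.

Definition block_start (j : nat) : nat := \sum_(0 <= i < j) len i.

(** Advancing by at most one block per letter is correct once all blocks are nonempty. *)
Fixpoint block_index (x : nat) : nat :=
  if x is x'.+1 then
    let j := block_index x' in if x < block_start j.+1 then j else j.+1
  else 0.

Hypothesis len_gt0 : forall j, 0 < len j.

Lemma block_startS j : block_start j.+1 = block_start j + len j.
Proof. by rewrite /block_start big_nat_recr. Qed.

Lemma block_start_leq i j : i <= j -> block_start i <= block_start j.
Proof.
move=> /subnK <-; elim: (j - i) => // k IH.
by rewrite addSn block_startS (leq_trans IH) // leq_addr.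
Qed.

Lemma block_indexP x :
  block_start (block_index x) <= x < block_start (block_index x).+1.
Proof.
elim: x => [|x /andP[IH1 IH2]] /=.
  by rewrite block_startS {1 2}/block_start big_geq //= len_gt0.
case: ifP => [->|/negbT]; first by rewrite andbT (leq_trans IH1).
by rewrite -leqNgt => H; rewrite H /= [X in _ < X]block_startS;
  have := len_gt0 (block_index x).+1; lia.
Qed.

Lemma block_index_unique x j :
  block_start j <= x < block_start j.+1 -> block_index x = j.
Proof.
move=> /andP[lo hi]; have /andP[lo' hi'] := block_indexP x.
case: (ltngtP (block_index x) j) => // /block_start_leq; lia.
Qed.

Lemma block_index_leq x y : x <= y -> block_index x <= block_index y.
Proof.
move=> xy; rewrite leqNgt; apply/negP => /block_start_leq.
by have := block_indexP x; have := block_indexP y; lia.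
Qed.

End Blocks.

(* Parity separates consecutive blocks, so a repeat either stays inside one
   block or has a period exceeding the length of a much longer block. *)
Lemma parity_repeats (len : nat -> nat) (K a p l : nat) :
  (forall j, 0 < len j) -> (forall j, 2 * K * len j <= len j.+1) -> 0 < K ->
  repeats (fun x => odd (block_index len x)) a p l -> 0 < p -> 0 < l ->
  K * l <= p \/
  a + p + l <= block_start len (block_index len a).+1.
Proof.
move=> len0 grow K0 rep p0 l0.
pose e := block_start len; pose bi := block_index len.
have eS j : e j.+1 = e j + len j by exact: block_startS.
set i := bi a; set j := bi (a + p).
have /andP[ilo ihi] : e i <= a < e i.+1 by exact: block_indexP.
have /andP[jlo jhi] : e j <= a + p < e j.+1 by exact: block_indexP.
have ij : i <= j by apply: block_index_leq; rewrite ?leq_addr.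
have par : odd i = odd j by have := rep 0 l0; rewrite !addn0.
have e_leq m m' : m <= m' -> e m <= e m' by exact: block_start_leq.
have len_lt m : len m < len m.+1.
  by have := len0 m; have := grow m; nia.
have len_mono m m' : m <= m' -> len m <= len m'.
  move=> /subnK <-; elim: (m' - m) => // c IH.
  by rewrite addSn (leq_trans IH) // ltnW.
case: (ltngtP i j) ij => // [ltij _|ijE _]; last first.
  (* If the second occurrence left block [i], its letter at [e i.+1] would have odd index distance
     one from its counterpart, still in block [i]. *)
  right; rewrite leqNgt; apply/negP => out.
  have k1 : e i.+1 - (a + p) < l by move: out; rewrite -/bi -/i -/e; lia.
  have := rep _ k1; rewrite subnKC; last by rewrite ijE ltnW.
  have -> : block_index len (a + (e i.+1 - (a + p))) = i.
    by apply: block_index_unique => //; rewrite -/e; lia.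
  have -> : block_index len (e i.+1) = i.+1.
    by apply: block_index_unique => //; rewrite -/e leqnn [e i.+2]eS;
      have := len0 i.+1; lia.
  by rewrite /=; case: odd.
left.
have {par} ltij2 : i.+2 <= j.
  have : i.+1 != j by apply/negP => /eqP E; move: par; rewrite -E /=; case: odd.
  by clear par; lia.
have := e_leq _ _ ltij2; rewrite !eS => ej.
(* All of block [i.+1] lies between [a] and [a + p]. When the first occurrence stays in block [i],
   this gives [l <= len i] and [len i.+1 <= p]. *)
have [small|out] := leqP (a + l) (e i.+1).
  have : l <= len i by rewrite eS in small; lia.
  have : len i.+1 <= p by rewrite eS in ihi; lia.
  move: (grow i); clear; nia.
have k1 : e i.+1 - a < l by lia.
have k0 : (e i.+1 - a).-1 < l by lia.
(* The first occurrence crosses [e i.+1]. The parity change there recurs at [x], which must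
   therefore start a block [m], and [m] lies beyond [j]. *)
pose x := e i.+1 + p; pose m := bi x.
have E1 : a + (e i.+1 - a) = e i.+1 by lia.
have E1' : a + p + (e i.+1 - a) = x by rewrite /x; lia.
have E0 : a + (e i.+1 - a).-1 = (e i.+1).-1 by lia.
have E0' : a + p + (e i.+1 - a).-1 = x.-1 by rewrite /x; lia.
have B1 : bi (e i.+1) = i.+1.
  by apply: block_index_unique => //; rewrite -/e leqnn [e i.+2]eS;
      have := len0 i.+1; lia.
have B0 : bi (e i.+1).-1 = i.
  by apply: block_index_unique => //; rewrite -/e; have := len0 i; have := eS i; lia.
have R1 : odd i.+1 = odd m by rewrite -B1 -E1 /bi rep // E1'.
have R0 : odd i = odd (bi x.-1) by rewrite -{1}B0 -E0 /bi rep // E0'.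
have /andP[mlo mhi] : e m <= x < e m.+1 by exact: block_indexP.
have {R0} xm : x = e m.
  apply/eqP; rewrite eqn_leq mlo andbT leqNgt; apply/negP => H.
  have E : bi x.-1 = m.
    by apply: block_index_unique => //; rewrite -/e; clear -H mhi; lia.
  by move: R0; rewrite E -R1 /=; case: odd.
clear E1 E1' E0 E0' B1 B0 k0 k1.
have jm : j < m.
  clear R1; rewrite ltnNge; apply/negP => /e_leq; rewrite -xm /x; lia.
have lm : len i.+1 < len m.
  by apply: leq_trans (len_lt _) (len_mono _ _ _); clear -jm ltij2; lia.
(* Block [m] is longer than block [i.+1]: if the first occurrence reached [e i.+2], it would change
   parity while the second is still inside block [m]. *)
have pl : l <= len i + len i.+1.
  rewrite leqNgt; apply/negP => big.
  have [k2 E2 E3] : [/\ e i.+2 - a < l, a + (e i.+2 - a) = e i.+2 &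
      a + p + (e i.+2 - a) = x + len i.+1].
    by rewrite /x; have := eS i; have := eS i.+1; clear R1; split; lia.
  have := rep _ k2; rewrite E2 E3.
  have -> : block_index len (e i.+2) = i.+2.
    apply: block_index_unique => //; rewrite -/e leqnn [e i.+3]eS.
    by have := len0 i.+2; clear; lia.
  have -> : block_index len (x + len i.+1) = m.
    apply: block_index_unique => //; rewrite -/e [e m.+1]eS -xm.
    by clear -lm; lia.
  by rewrite -R1 /=; case: odd.
clear R1.
have : len i.+2 <= p.
  have : e i.+3 <= e m by apply: e_leq; lia.
  by rewrite -xm /x !eS; lia.
(* Here [K * l <= 2 * K * len i.+1 <= len i.+2 <= p], which explains the growth factor [2 * K]. *)
move: (grow i) (grow i.+1) pl (len_lt i); clear; nia.
Qed.

(** * The infinite concatenation of powers *)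

Definition power_length (n K j : nat) : nat := (n * K + 1) * (2 * K) ^ j.

(** Block [j] is u^n u' with |u'| = [d] and |u| = [K * d], hence of length [(n * K + 1) * d]. A
    letter consists of the block parity, the mark of u' and a letter of [X], chosen anew for each
    length. *)
Definition powers_word (n K : nat) (X : nat -> nat -> nat) (x : nat) :
    bool * (bool * nat) :=
  let j := block_index (power_length n K) x in
  let d := (2 * K) ^ j in
  (odd j, marked_power (X (K * d)) d (K * d)
            (x - block_start (power_length n K) j)).

Lemma power_length_gt0 n K j : 0 < K -> 0 < power_length n K j.
Proof. by move=> K0; rewrite muln_gt0 addn1 expn_gt0 muln_gt0 K0. Qed.

Lemma powers_wordE n K X j o : 0 < K -> o < power_length n K j ->
  powers_word n K X (block_start (power_length n K) j + o) =
  (odd j, marked_power (X (K * (2 * K) ^ j)) ((2 * K) ^ j) (K * (2 * K) ^ j) o).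
Proof.
move=> K0 oj; rewrite /powers_word.
rewrite (@block_index_unique _ _ _ j) ?addKn //.
  by move=> i; exact: power_length_gt0.
by rewrite leq_addr block_startS ltn_add2l.
Qed.

Lemma powers_word_repeats n K X a p l : 0 < n -> 1 < K ->
  (forall m i p l, 0 < p -> i + p + l <= m -> repeats (X m) i p l ->
     K * K * l <= p) ->
  0 < p -> repeats (powers_word n K X) a p l -> (p + l) * K <= (n * K + 1) * p.
Proof.
move=> n0 K1 HX p0 rep.
have small : K * l <= p -> (p + l) * K <= (n * K + 1) * p by nia.
case: (posnP l) => [l0|l0]; first by apply: small; rewrite l0 muln0.
have K0 : 0 < K by exact: ltnW.
have len0 j : 0 < power_length n K j by exact: power_length_gt0.
have grow j : 2 * K * power_length n K j <= power_length n K j.+1.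
  by rewrite /power_length expnS mulnCA leqnn.
have := @parity_repeats _ K a p l len0 grow K0 _ p0 l0.
case=> [k kl|//|].
  by have := congr1 fst (rep k kl).
set j := block_index _ a => inj.
have /andP[lo hi] := block_indexP len0 a.
rewrite -/j in lo hi; pose o := a - block_start (power_length n K) j.
have aE : a = block_start (power_length n K) j + o by rewrite subnKC.
pose d := (2 * K) ^ j.
have d0 : 0 < d by rewrite expn_gt0 muln_gt0 K0.
have end_o : o + p + l <= power_length n K j.
  by move: inj; rewrite block_startS aE -!addnA leq_add2l.
apply: (@marked_power_repeats (X (K * d)) n K d o p l) => //.
- exact: HX.
- by move: end_o; rewrite /power_length -/d; lia.
move=> k kl; have := congr1 snd (rep k kl).
by rewrite aE -!addnA !powers_wordE //; clear -kl end_o; lia.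
Qed.

(** Beyond the first period, block [j] still has [n - 1] periods and u', so it attains exponent
    [n + 1/K]. *)
Lemma powers_word_power n K X j : 0 < n -> 0 < K ->
  repeats (powers_word n K X) (block_start (power_length n K) j)
    (K * (2 * K) ^ j) (n.-1 * (K * (2 * K) ^ j) + (2 * K) ^ j).
Proof.
move=> n0 K0 k kl.
have H : K * (2 * K) ^ j + k < power_length n K j.
  by rewrite /power_length; case: (n) n0 kl => // n' _ /=; lia.
rewrite -addnA !powers_wordE //; last by apply: leq_ltn_trans H; exact: leq_addl.
by rewrite /marked_power modnDl.
Qed.

(** * Binary coding by blocks of fixed length *)

(* Every letter is coded by a block of even length that starts with 11, and 11
   occurs nowhere else; the single 1 at position 4 + 2e codes e, and only the
   blocks of marked letters have 1s beyond position 4 + 4k. *)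
Definition letter_bit (k : nat) (c : bool * (bool * nat)) (r : nat) : bool :=
  (r < 2) || [&& ~~ odd r, 4 <= r &
    (r == 4 + 2 * (c.2.2 + k * c.1)) || (c.2.1 && (4 + 4 * k <= r))].

Definition coded_word (k q : nat) (z : nat -> bool * (bool * nat)) (x : nat) :
    bool :=
  letter_bit k (z (x %/ q)) (x %% q).

(** The bit at [4 + 4 * k] reveals the mark. The single 1 at a position from 4 to below [4 + 4 * k]
    reveals [c.2.2 + k * c.1], which determines both terms as [c.2.2 < k]. *)
Lemma letter_bit_inj k c c' : c.2.2 < k -> c'.2.2 < k ->
  (forall r, r <= 4 + 4 * k -> letter_bit k c r = letter_bit k c' r) -> c = c'.
Proof.
case: c c' => [b [t x]] [b' [t' x']] /= xk xk' H.
have E (u v : nat) : 4 + 2 * u == 4 + 2 * v = (u == v) by lia.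
have ev u : odd (4 + 2 * u) = false by lia.
have bk (c : bool) y : y < k -> y + k * c < 2 * k by case: c; lia.
have tE : t = t'.
  have := H (4 + 2 * (2 * k)) ltac:(lia); rewrite /letter_bit !ev !E /=.
  have -> : (4 + 4 * k <= 4 + 2 * (2 * k)) by lia.
  have /ltn_eqF := bk b x xk; have /ltn_eqF := bk b' x' xk'.
  by rewrite ![2 * k == _]eq_sym => -> ->; rewrite !andbT.
have := H (4 + 2 * (x + k * b)) ltac:(have := bk b x xk; lia).
rewrite /letter_bit !ev !E /= eqxx /=.
have -> : (4 + 4 * k <= 4 + 2 * (x + k * b)) = false by have := bk b x xk; lia.
rewrite andbF orbF => /esym/eqP; rewrite tE.
by case: b b' {H bk tE} => [] [] ?; congr (_, (_, _)); lia.
Qed.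

Section Coding.
Variables (k A : nat) (z : nat -> bool * (bool * nat)).
Let q := 4 + 4 * k + 2 * A.
Let w := coded_word k q z.

Lemma coded_wordE i r : r < q -> w (q * i + r) = letter_bit k (z i) r.
Proof.
move=> rq; have q0 : 0 < q by exact: leq_ltn_trans rq.
rewrite /w /coded_word mulnC divnMDl // modnMDl divn_small // addn0.
by rewrite modn_small.
Qed.

(** A block has even length, so its last position is odd and carries 0: no 11 straddles two
    blocks. *)
Lemma coded_word_sync x : w x -> w x.+1 -> q %| x.
Proof.
have q0 : 0 < q by [].
rewrite (divn_eq x q) mulnC -addnS.
have := ltn_pmod x q0; move: (x %/ q) (x %% q) => i r rq.
have qodd : odd q = false by rewrite /q; lia.
rewrite coded_wordE // dvdn_addr ?dvdn_mulr //.
case: (ltnP r.+1 q) => rq'.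
  rewrite coded_wordE // /letter_bit.
  case: r rq rq' => [//|[//|r]] _ _ /=.
  by case/andP => H _ /and3P[]; rewrite H.
have rE : r.+1 = q by apply/eqP; rewrite eqn_leq rq rq'.
rewrite {1}/letter_bit => H _; move: H qodd; rewrite -rE /=.
case: ltnP => [|_ /andP[]]; last by case: odd.
by move: rE; rewrite /q; lia.
Qed.

(** A repeat of length [2 * q] contains the 11 opening some block; its shifted copy also opens a
    block, so [q] divides [p]. The incomplete blocks at both ends cost at most [2 * q]. *)
Lemma coded_word_repeats i p l : 0 < A -> (forall x, (z x).2.2 < k) ->
  2 * q <= l -> repeats w i p l ->
  exists i' p' l', [/\ p = q * p', l <= q * l' + 2 * q & repeats z i' p' l'].
Proof.
move=> A0 z_lt ql rep.
have q0 : 0 < q by [].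
have q1 : 1 < q by [].
(* [i'] indexes the first block starting strictly after [i]; if [i] itself starts a block, then
   [c = q]. *)
pose c := (q - i %% q); pose i' := (i %/ q).+1.
have iq := ltn_pmod i q0.
have ic : i + c = q * i'.
  rewrite {1}(divn_eq i q) /c -addnA subnKC; last exact: ltnW.
  by rewrite /i' mulnS mulnC addnC.
have cq : c <= q by exact: leq_subr.
have q1p : q * i' + 0 = q * i' by rewrite addn0.
have w0 : w (q * i') by rewrite -q1p coded_wordE.
have w1 : w (q * i' + 1) by rewrite coded_wordE.
have R u : c + u < l -> w (q * i' + p + u) = w (q * i' + u).
  by move=> ul; have := rep _ ul; rewrite addnA ic => ->; congr w; clear -ic; lia.
have qp : q %| p.
  have : q %| q * i' + p; last by rewrite dvdn_addr // dvdn_mulr.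
  apply: coded_word_sync.
    by rewrite -[_ + p]addn0 R ?addn0 //; clear -cq ql q1; lia.
  by rewrite -addn1 R //; clear -cq ql q1; lia.
have /dvdnP[p' pE] := qp; rewrite mulnC in pE.
exists i', p', ((l - c) %/ q); split=> //.
  have := divn_eq (l - c) q; have := ltn_pmod (l - c) q0.
  rewrite mulnC; move: (q * _) (_ %% q) => u v.
  by clear -cq; lia.
move=> m ml; apply: (@letter_bit_inj k) => // r rk.
have rq : r < q by rewrite /q; lia.
have mq : q * m + q <= l - c.
  rewrite -mulnSr mulnC; apply: leq_trans (leq_trunc_div (l - c) q).
  by rewrite leq_mul2r ml orbT.
rewrite -!coded_wordE // !mulnDr -pE.
rewrite -(addnA (q * i') (q * m)) -(addnA (q * i' + p) (q * m)) R //.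
by rewrite -ltn_subRL; apply: leq_trans mq; rewrite ltn_add2l.
Qed.

(** The length of the image of a letter under [spread_morph]. *)
Definition letter_weight (L : nat) (b : bool) : nat := if b then L else 1.

Lemma marked_block_weight L (c : bool * (bool * nat)) : c.2.1 ->
  A * L <= \sum_(0 <= r < q) letter_weight L (letter_bit k c r).
Proof.
move=> c1; rewrite (@big_cat_nat _ _ _ (4 + 4 * k)) //=; last exact: leq_addr.
apply: leq_trans (leq_addl _ _).
rewrite /q; elim: A => [|B IH]; first by rewrite mul0n.
rewrite mulnS addnCA; set t := 4 + 4 * k + 2 * B in IH *.
have bt : letter_bit k c t.
  by rewrite /letter_bit c1; apply/orP; right; rewrite /t; lia.
have : 4 + 4 * k <= t by exact: leq_addr.
move: (4 + 4 * k) t bt IH => s t bt IH st.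
rewrite big_nat_recr ?leqW //= big_nat_recr //= bt.
by apply: leq_trans (leq_addr _ _); rewrite mulSn addnC leq_add2r.
Qed.

(** The 1s are the opening two and the one at [e]. The bound is proved for every prefix length [t]
    so that induction applies. *)
Lemma unmarked_block_weight L (c : bool * (bool * nat)) : ~~ c.2.1 ->
  \sum_(0 <= r < q) letter_weight L (letter_bit k c r) <= q + 3 * L.
Proof.
move=> /negbTE c1; pose e := 4 + 2 * (c.2.2 + k * c.1).
suff H t : \sum_(0 <= r < t) letter_weight L (letter_bit k c r)
    <= t + L * minn t 2 + L * (e < t).
  by apply: leq_trans (H q) _; case: (e < q); rewrite /q; lia.
elim: t => [|t IH]; first by rewrite big_geq.
rewrite big_nat_recr //=; apply: leq_trans (leq_add IH (leqnn _)) _.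
have bE : letter_bit k c t -> (t < 2) || (t == e).
  by rewrite /letter_bit c1 orbF => /orP[->//|/and3P[_ _ ->]]; rewrite orbT.
have eS : (e < t : nat) <= (e < t.+1) by case: (ltnP e t) => // /leqW ->.
have mS : minn t 2 <= minn t.+1 2 by lia.
have LeS : L * (e < t) <= L * (e < t.+1) by rewrite leq_mul2l eS orbT.
have LmS : L * minn t 2 <= L * minn t.+1 2 by rewrite leq_mul2l mS orbT.
rewrite /letter_weight; case: ifP => [/bE/orP[t2|/eqP te]|_]; last lia.
  have -> : minn t.+1 2 = (minn t 2).+1 by lia.
  rewrite mulnS; lia.
by rewrite te ltnSn ltnn in LeS LmS *; lia.
Qed.

End Coding.

Lemma coded_word_sum k q z (F : bool -> nat) i m : 0 < q ->
  \sum_(0 <= x < q * m) F (coded_word k q z (q * i + x)) =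
  \sum_(0 <= t < m) \sum_(0 <= r < q) F (letter_bit k (z (i + t)) r).
Proof.
move=> q0; elim: m => [|m IH]; first by rewrite muln0 !big_geq.
rewrite big_nat_recr //= -IH mulnSr (@big_cat_nat _ _ _ (q * m)) ?leq_addr //=.
congr (_ + _); rewrite -{1}[q * m]add0n big_addn addKn.
apply: eq_big_nat => r /andP[_ rq]; congr F.
rewrite /coded_word addnCA -mulnDr addnC mulnC divnMDl // modnMDl.
by rewrite divn_small // modn_small // addn0.
Qed.

(** The error [2 * q * K] comes from aligning repeats with blocks and is negligible for long
    factors. With 1s of weight [q], an unmarked block weighs at most [4 * q] and a marked one at
    least [A * q]; this gives the ratio [4 * K / A]. *)
Lemma exists_uneven_power_word (n K A : nat) : 0 < n -> 1 < K -> 0 < A ->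
  exists (w : nat -> bool) (q : nat), [/\ 0 < q,
    forall i p l, 0 < p -> repeats w i p l ->
      (p + l) * K <= (n * K + 1) * p + 2 * q * K &
    forall j, exists i d, [/\ j <= d, 0 < d,
      repeats w i (K * d) (n.-1 * (K * d) + d) &
      A * \sum_(0 <= x < K * d - d) letter_weight q (w (i + d + x)) <=
      4 * K * \sum_(0 <= x < d) letter_weight q (w (i + x))]].
Proof.
move=> n0 K1 A0; have K0 : 0 < K by exact: ltnW.
have /choice[X HX] : forall m, exists X : nat -> nat,
    (forall i, X i < 2 * (K * K) + 2) /\
    forall i p l, 0 < p -> i + p + l <= m -> repeats X i p l -> K * K * l <= p.
  by move=> m; apply: exists_nonrepetitive_word; nia.
pose k := 2 * (K * K) + 2; pose q := 4 + 4 * k + 2 * A.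
pose z := powers_word n K X; pose w := coded_word k q z.
have q0 : 0 < q by [].
have z_lt x : (z x).2.2 < k by exact: (HX _).1.
exists w, q; split=> // [i p l p0 rep|j].
  have K_le : p * K <= (n * K + 1) * p by clear -n0; nia.
  have [ql|lq] := leqP (2 * q) l; last first.
    rewrite mulnDl; apply: leq_add => //.
    by rewrite leq_mul2r ltnW ?orbT.
  have [i' [p' [l' [pE lE rep']]]] := coded_word_repeats A0 z_lt ql rep.
  have p'0 : 0 < p' by case: p' pE {rep'} => //;
    rewrite muln0 => pE; rewrite pE in p0.
  have := @powers_word_repeats n K X i' p' l' n0 K1 _ p'0 rep'.
  move=> /(_ (fun m => (HX m).2)) main.
  have := leq_mul (leqnn q) main.
  have := leq_mul lE (leqnn K); rewrite pE -!/q.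
  clearbody q; clear; nia.
pose d := (2 * K) ^ j; pose e := block_start (power_length n K) j.
have d0 : 0 < d by rewrite expn_gt0 muln_gt0 K0.
have jd : j < d by apply: ltn_expl; nia.
have zE t : t < K * d -> z (e + t) = (odd j, (t < d, X (K * d) t)).
  move=> tK; rewrite /z /e powers_wordE // -?/d /marked_power ?modn_small //.
  by apply: leq_trans tK _; rewrite /power_length -/d; clear -n0; nia.
exists (q * e), (q * d); split.
- by rewrite (leq_trans (ltnW jd)) // leq_pmull.
- by rewrite muln_gt0 q0.
- move=> x xl.
  have -> : q * e + K * (q * d) + x = q * (e + K * d) + x by clearbody q; clear; nia.
  have xE u : q * u + x = q * (u + x %/ q) + x %% q.
    by rewrite mulnDr -(addnA (q * u)) [q * (x %/ q)]mulnC -divn_eq.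
  have rx := ltn_pmod x q0; rewrite !xE.
  rewrite /w !coded_wordE // /z /e powers_word_power //.
  rewrite ltn_divLR //; apply: leq_trans xl _.
  by rewrite -/d; clearbody q; clear; nia.
have -> : K * (q * d) - q * d = q * (K * d - d).
  by rewrite mulnBr mulnCA.
rewrite -mulnDr !coded_word_sum //.
have lo : d * (A * q) <= \sum_(0 <= t < d) \sum_(0 <= r < q)
    letter_weight q (letter_bit k (z (e + t)) r).
  rewrite -[d in d * _]subn0 -sum_nat_const_nat.
  rewrite !big_nat; apply: leq_sum => t /andP[_ td].
  apply: marked_block_weight; rewrite zE //=.
  by apply: leq_trans td _; rewrite leq_pmull.
have hi : \sum_(0 <= t < K * d - d) \sum_(0 <= r < q)
    letter_weight q (letter_bit k (z (e + d + t)) r) <= (K * d - d) * (q + 3 * q).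
  rewrite -[X in _ <= X * _]subn0 -sum_nat_const_nat.
  rewrite !big_nat; apply: leq_sum => t /andP[_ td].
  apply: unmarked_block_weight => //; rewrite -addnA zE /= -?leqNgt ?leq_addr //.
  by rewrite -ltn_subRL.
apply: leq_trans (leq_mul (leqnn A) hi) _.
apply: leq_trans (leq_mul (leqnn (4 * K)) lo).
have : (K * d - d) * (4 * A * q) <= K * d * (4 * A * q)
  by rewrite leq_mul2r leq_subr orbT.
by clearbody q; move: (K * d - d); clear; nia.
Qed.

Import Order.TTheory GRing.Theory Num.Theory.
Local Open Scope classical_set_scope.
Local Open Scope ring_scope.

(** * Exponents and the asymptotic critical exponent in terms of repeats *)

Lemma nth_flatten_nseq {T : Type} (x0 : T) (v : seq T) (m k : nat) :
  (k < m * size v)%N -> nth x0 (flatten (nseq m v)) k = nth x0 v (k %% size v).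
Proof.
elim: m k => [|m IH] k; first by rewrite mul0n ltn0.
rewrite mulSn /= nth_cat => km; case: ltnP => kv; first by rewrite modn_small.
rewrite IH; last by rewrite ltn_subLR.
by rewrite -{2}(subnK kv) modnDr.
Qed.

Lemma size_prefix_pow {T : Type} (v : seq T) (p : nat) :
  (0 < size v)%N -> size (prefix_pow v p) = p.
Proof.
move=> v0; rewrite /prefix_pow size_takel // size_flatten /shape map_nseq.
by rewrite sumn_nseq mulnC leq_pmulr.
Qed.

Lemma nth_prefix_pow {T : Type} (x0 : T) (v : seq T) (p k : nat) :
  (0 < size v)%N -> (k < p)%N ->
  nth x0 (prefix_pow v p) k = nth x0 v (k %% size v).
Proof.
move=> v0 kp; rewrite nth_take // nth_flatten_nseq //.
by apply: leq_trans kp _; rewrite leq_pmulr.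
Qed.

Lemma repeats_modn {T : Type} (w : nat -> T) (i p l k : nat) :
  repeats w i p l -> (k < p + l)%N -> w (i + k)%N = w (i + k %% p)%N.
Proof.
move=> rep; case: (posnP p) => [->|p0]; first by rewrite modn0.
elim/ltn_ind: k => k IH kpl; case: (ltnP k p) => kp; first by rewrite modn_small.
rewrite -{1}(subnKC kp) addnA -rep ?ltn_subLR // IH; last 2 first.
- by rewrite ltn_subrL p0 (leq_trans p0 kp).
- by rewrite (leq_ltn_trans _ kpl) // leq_subr.
by rewrite -{2}(subnK kp) modnDr.
Qed.

Lemma E_ge {R : realType} {T : Type} (w : nat -> T) (i p l : nat) :
  (0 < p)%N -> repeats w i p l ->
  (((p + l)%:R / p%:R : R)%:E <=
    E (mkseq (fun k => w (i + k)%N) (p + l)))%E.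
Proof.
move=> p0 rep; apply: ereal_sup_ubound.
exists ((p + l)%:R / p%:R); last by rewrite rmorphM fmorphV /= !ratr_nat.
exists (mkseq (fun k => w (i + k)%N) p); rewrite size_mkseq; split=> //.
exists (p + l)%N; split=> //.
have v0 : (0 < size (mkseq (fun k => w (i + k)%N) p))%N by rewrite size_mkseq.
apply: (@eq_from_nth _ (w 0%N)); rewrite ?size_prefix_pow ?size_mkseq // => k kpl.
rewrite nth_prefix_pow // size_mkseq !nth_mkseq ?ltn_pmod //.
exact: repeats_modn rep kpl.
Qed.

Lemma E_le {R : realType} {T : Type} (w : nat -> T) (i m : nat) (c : R) :
  1 <= c ->
  (forall p l, (0 < p)%N -> m = (p + l)%N -> repeats w i p l ->
     (p + l)%:R <= c * p%:R) ->
  (E (mkseq (fun k => w (i + k)%N) m) <= c%:E)%E.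
Proof.
move=> c1 H; apply: ge_ereal_sup => _ [_ [v [v0 [p [-> xE]]]] <-].
have mp : m = p by rewrite -(size_prefix_pow p v0) -xE size_mkseq.
subst p; rewrite rmorphM fmorphV /= !ratr_nat lee_fin ler_pdivrMr ?ltr0n //.
(* A root at least as long as the factor gives exponent at most 1, covered by [1 <= c]; a shorter
   one gives a repeat of length [m - size v]. *)
case: (leqP m (size v)) => mv.
  apply: le_trans (_ : (size v)%:R <= _); first by rewrite ler_nat.
  by rewrite ler_peMl.
have mE : m = (size v + (m - size v))%N by rewrite subnKC // ltnW.
rewrite {1}mE; apply: H => // k kl.
have km : (size v + k < m)%N by rewrite -ltn_subRL.
have X0 j : (j < m)%N -> w (i + j)%N = nth (w 0%N) v (j %% size v).
  by move=> jm; rewrite -(nth_prefix_pow _ v0 jm) -xE nth_mkseq.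
rewrite -addnA !X0 ?modnDl //.
by apply: leq_ltn_trans km; exact: leq_addl.
Qed.

Lemma ACE_le {R : realType} {T : Type} (w : nat -> T) (m0 : nat) (c : R) :
  1 <= c ->
  (forall i p l, (0 < p)%N -> (m0 <= p + l)%N -> repeats w i p l ->
     (p + l)%:R <= c * p%:R) ->
  (ACE w <= c%:E)%E.
Proof.
(* Unfolded, the limsup is an infimum over neighbourhoods of infinity; the tail from [m0] is one of
   them. *)
move=> c1 H; rewrite /ACE /limn_esup /limf_esup.
apply: ereal_inf_le; exists (ereal_sup ((fun m => ereal_sup
  [set (E x : \bar R) | x in Fact w m]) @` [set m | (m0 <= m)%N])).
  by exists [set m | (m0 <= m)%N] => //; exact: nbhs_infty_ge.
apply: ge_ereal_sup => _ [m /= m0m <-].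
apply: ge_ereal_sup => _ [_ [i ->] <-].
by apply: E_le => // p l p0 mE; apply: H => //; rewrite -mE.
Qed.

Lemma ACE_ge {R : realType} {T : Type} (w : nat -> T) (c : R) :
  (forall m, exists i p l, [/\ (0 < p)%N, (m <= p + l)%N, repeats w i p l &
     c * p%:R <= (p + l)%:R]) ->
  (c%:E <= ACE w)%E.
Proof.
move=> H; rewrite /ACE /limn_esup /limf_esup.
apply: le_ereal_inf_tmp => _ [V [m0 _ Vm0] <-].
have [i [p [l [p0 m0l rep cp]]]] := H m0.
apply: le_trans (_ : (((p + l)%:R / p%:R : R)%:E <= _)%E).
  by rewrite lee_fin ler_pdivlMr ?ltr0n.
apply: le_trans (E_ge p0 rep) _.
apply: le_trans (_ : (ereal_sup [set (E x : \bar R) | x in Fact w (p + l)] <= _)%E).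
  apply: ereal_sup_ubound; exists (mkseq (fun k => w (i + k)%N) (p + l)) => //.
  by exists i.
by apply: ereal_sup_ubound; exists (p + l)%N => //; exact: Vm0.
Qed.

(** * Repeats in the image of a word under a morphism *)

Section MorphismImage.
Context {S G : Type} (x0 : G) (h : S -> seq G) (w : nat -> S).

Lemma size_morph_ext m (u : nat -> S) :
  size (morph_ext h (mkseq u m)) = (\sum_(0 <= k < m) size (h (u k)))%N.
Proof.
rewrite /morph_ext size_flatten /shape -map_comp sumnE big_map /mkseq big_map.
by rewrite /index_iota subn0.
Qed.

Lemma morph_ext_cat s t : morph_ext h (s ++ t) = morph_ext h s ++ morph_ext h t.
Proof. by rewrite /morph_ext map_cat flatten_cat. Qed.

Lemma mkseq_addn (u : nat -> S) i m :
  mkseq u (i + m) = mkseq u i ++ mkseq (fun k => u (i + k)%N) m.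
Proof.
rewrite /mkseq iotaD map_cat add0n; congr (_ ++ _).
by rewrite -{1}[i]addn0 iotaDl -map_comp.
Qed.

Lemma nth_morph_ext_mkseq m m' j :
  (j < size (morph_ext h (mkseq w m)))%N ->
  (j < size (morph_ext h (mkseq w m')))%N ->
  nth x0 (morph_ext h (mkseq w m)) j = nth x0 (morph_ext h (mkseq w m')) j.
Proof.
wlog mm' : m m' / (m <= m')%N.
  by move=> H j1 j2; case/orP: (leq_total m m') => /H; [|move/(_ j2 j1)]; auto.
by move=> jm _; rewrite -(subnKC mm') mkseq_addn morph_ext_cat nth_cat jm.
Qed.

Hypothesis h_gt0 : forall c, (0 < size (h c))%N.

Lemma morph_wordE i m k :
  (k < size (morph_ext h (mkseq (fun k => w (i + k)%N) m)))%N ->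
  morph_word x0 h w (size (morph_ext h (mkseq w i)) + k)%N =
  nth x0 (morph_ext h (mkseq (fun k => w (i + k)%N) m)) k.
Proof.
move=> km; rewrite /morph_word (@nth_morph_ext_mkseq _ (i + m)%N).
- by rewrite mkseq_addn morph_ext_cat nth_cat ltnNge leq_addr addKn.
(* The image of [j + 1] letters has more than [j] letters, because every letter image is
   nonempty. *)
- move: (_ + k)%N => j; rewrite size_morph_ext.
  apply: leq_trans (_ : (\sum_(0 <= i < j.+1) 1 <= _)%N); last exact: leq_sum.
  by rewrite sum_nat_const_nat subn0 muln1.
- by rewrite mkseq_addn morph_ext_cat size_cat ltn_add2l.
Qed.

Lemma morph_word_repeats i p l : repeats w i p l ->
  repeats (morph_word x0 h w) (\sum_(0 <= k < i) size (h (w k)))%N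
    (\sum_(0 <= k < p) size (h (w (i + k))))%N
    (\sum_(0 <= k < l) size (h (w (i + k))))%N.
Proof.
move=> rep k; rewrite -!size_morph_ext => kl.
have eqs : mkseq (fun k => w (i + k)%N) l = mkseq (fun k => w (i + p + k)%N) l.
  by apply/eq_in_map => j; rewrite mem_iota => /= jl; exact: rep.
rewrite (morph_wordE kl) -size_cat -morph_ext_cat -mkseq_addn.
by rewrite eqs in kl *; rewrite (morph_wordE kl).
Qed.

End MorphismImage.

Lemma repeats_sum {T : Type} (w : nat -> T) (F : T -> nat) i p n b :
  repeats w i p (n * p + b) ->
  (\sum_(0 <= k < n * p + b) F (w (i + k)) =
   n * \sum_(0 <= k < p) F (w (i + k)) + \sum_(0 <= k < b) F (w (i + k)))%N.
Proof.
elim: n => [|n IH] rep; first by rewrite !mul0n.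
rewrite mulSn -addnA mulSn -addnA -IH; last first.
  by move=> k kl; apply: rep; rewrite mulSn -addnA (leq_trans kl) // leq_addl.
rewrite (@big_cat_nat _ _ _ p) ?leq_addr //=; congr addn.
rewrite -{1}[p]add0n big_addn addKn; apply: eq_big_nat => k /andP[_ kl].
rewrite [(k + p)%N]addnC addnA -rep //.
by rewrite mulSn -addnA (leq_trans kl) // leq_addl.
Qed.

(** * The injective morphism and the final estimates *)

Definition spread_morph {G : Type} (g0 g1 : G) (L : nat) (b : bool) : seq G :=
  if b then nseq L g1 else [:: g0].

Lemma size_spread_morph {G : Type} (g0 g1 : G) L b :
  size (spread_morph g0 g1 L b) = letter_weight L b.
Proof. by case: b; rewrite ?size_nseq. Qed.

(** As [g0 <> g1], the first letter of an image determines the first source letter, whose image then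
    cancels. *)
Lemma spread_morph_inj {G : Type} (g0 g1 : G) L : (0 < L)%N -> g0 <> g1 ->
  injective_morph (spread_morph g0 g1 L).
Proof.
case: L => // L _ g01; elim=> [|a s IH] [|b t] //=.
- by case: b.
- by case: a.
rewrite /morph_ext /= -!/(morph_ext _ _); case: a b => [] [] //=.
- by case=> /(congr1 (drop L)); rewrite !drop_size_cat ?size_nseq // => /IH ->.
- by case=> /esym.
- by case=> /g01.
- by case=> /IH ->.
Qed.

Lemma exists_nat_scale {R : realType} (a b : R) : 0 < a -> 0 <= b ->
  exists k : nat, (1 < k)%N /\ b <= a * k%:R.
Proof.
move=> a0 b0; exists (Num.bound (b / a)).+2; split=> //.
rewrite mulrC -ler_pdivrMr // ltW // (lt_le_trans (archi_boundP _)) //.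
  by rewrite divr_ge0 // ltW.
by rewrite ler_nat leqW.
Qed.

Theorem theorem33 (R : realType) (n : nat) (lambda delta : R) :
  (1 <= n)%N -> 0 < lambda < 1 -> 0 < delta ->
  exists w : nat -> bool,
    ((n%:R)%:E < ACE (R:=R) w)%E /\ (ACE (R:=R) w <= (n%:R + lambda)%:E)%E /\
    forall G : finType, (2 <= #|G|)%N ->
      ((n%:R + 1 - delta)%:E <= ACE_I G w :> \bar R)%E.
Proof.
move=> n1 /andP[lam0 lam1] del0.
(* [K] gives [1/K <= lambda / 2], leaving the other half to absorb the error [2 * q]; [A] gives
   [4 * K / A <= delta]. *)
have [K [K1 lamK]] := exists_nat_scale lam0 (ler0n R 2).
have [A [A1 delA]] := exists_nat_scale del0 (ler0n R (4 * K)).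
have [w [q [q0 upper lower]]] := exists_uneven_power_word n1 K1 (ltnW A1).
have K0 : (0 : R) < K%:R by rewrite ltr0n ltnW.
have A0 : (0 : R) < A%:R by rewrite ltr0n ltnW.
have n_ge1 : (1 : R) <= n%:R by rewrite ler1n.
have lenE d : (K * d + (n.-1 * (K * d) + d) = n * (K * d) + d)%N.
  by rewrite addnA -mulSn prednK.
exists w; split; [|split].
- apply: (@lt_le_trans _ _ (n%:R + K%:R^-1)%:E).
    by rewrite lte_fin ltrDl invr_gt0.
  apply: ACE_ge => m; have [i [d [md d0 rep _]]] := lower m.
  exists i, (K * d)%N, (n.-1 * (K * d) + d)%N; split=> //.
  + by rewrite muln_gt0 d0 ltnW.
  + by rewrite addnA (leq_trans md) // leq_addl.
  + by rewrite lenE natrD !natrM mulrDl [_^-1 * _]mulrA mulVf ?mul1r // gt_eqF.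
(* If [y > (n + lambda) * x], the upper bound forces [x <= 4 * q / lambda], and then [y] stays below
   this constant, hence below [m0]. *)
- have B0 : 0 <= (n%:R + 1) * (4 * q%:R / lambda) + 2 * q%:R + 1.
    by rewrite !addr_ge0 // mulr_ge0 ?addr_ge0 // divr_ge0 ?mulr_ge0 // ltW.
  have [m0 [_ m0B]] := exists_nat_scale (@ltr01 R) B0.
  apply: (@ACE_le _ _ _ m0); first by lra.
  move=> i p l p0 m0l /(upper _ _ _ p0).
  rewrite -(ler_nat R) natrD !natrM (natrD _ (n * K)%N) natrM.
  move: m0l; rewrite -(ler_nat R); move: m0B; rewrite mul1r.
  set y := (p + l)%:R; set x := p%:R => m0B m0y H.
  have x0 : 0 <= x :> R by exact: ler0n.
  have H2 : y <= (n%:R + lambda / 2) * x + 2 * q%:R.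
    rewrite -(ler_pM2r K0) (le_trans H) //.
    have : 2 * x <= lambda * K%:R * x by rewrite ler_wpM2r.
    by rewrite -subr_ge0 => ?; nra.
  have [?|lt] := leP y ((n%:R + lambda) * x); first by [].
  have xq : x <= 4 * q%:R / lambda by rewrite ler_pdivlMr //; lra.
  have : (n%:R + 1) * x <= (n%:R + 1) * (4 * q%:R / lambda).
    by rewrite ler_wpM2l //; lra.
  have : lambda * x <= x by rewrite ler_piMl // ltW.
  lra.
move=> G /card_gt1P[g0 [g1 [_ _ /eqP g01]]].
pose h := spread_morph g0 g1 q; pose W := morph_word g0 h w.
have hE b : size (h b) = letter_weight q b by exact: size_spread_morph.
have h0 b : (0 < size (h b))%N by rewrite hE; case: b.
apply: (@le_trans _ _ (ACE W)); last first.
  by apply: ereal_sup_ubound; exists h, g0; split=> //; exact: spread_morph_inj.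
apply: ACE_ge => m; have [i [d [md d0 rep AS]]] := lower m.
(* [D] and [S] are the image lengths of u' and u'', so the image of the power has exponent
   [n + D / (D + S)]. *)
set D := (\sum_(0 <= x < d) _)%N in AS; set S := (\sum_(0 <= x < _ - d) _)%N in AS.
have PE : (\sum_(0 <= k < K * d) size (h (w (i + k))) = D + S)%N.
  rewrite (@big_cat_nat _ _ _ d) ?leq_pmull ?(ltnW K1) //=; congr addn.
    by apply: eq_bigr => k _; rewrite hE.
  rewrite -{1}[d]add0n big_addn; apply: eq_bigr => k _.
  by rewrite hE -addnA [(d + k)%N]addnC.
have LE : (\sum_(0 <= k < n.-1 * (K * d) + d) size (h (w (i + k))) =
    n.-1 * (D + S) + D)%N.
  rewrite (repeats_sum (fun b => size (h b)) rep) PE; congr addn.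
  by apply: eq_bigr => k _; rewrite hE.
have dD : (d <= D)%N.
  apply: leq_trans (_ : (\sum_(0 <= x < d) 1 <= _)%N).
    by rewrite sum_nat_const_nat subn0 muln1.
  by apply: leq_sum => x _; rewrite -hE.
have := morph_word_repeats g0 h0 rep; rewrite PE LE => repW.
exists (\sum_(0 <= k < i) size (h (w k)))%N, (D + S)%N, (n.-1 * (D + S) + D)%N.
split=> //.
- by rewrite addn_gt0 (leq_trans d0).
- by rewrite addnA (leq_trans md) // (leq_trans dD) // leq_addl.
rewrite addnA -mulSn prednK // !natrD natrM !natrD.
(* This gives [D / (D + S) >= 1 - delta]; it follows from [A * S <= 4 * K * D] and the choice of
   [A]. *)
have : S%:R <= delta * D%:R :> R.
  rewrite -(ler_pM2l A0); move: AS; rewrite -(ler_nat R) !natrM => AS.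
  apply: le_trans AS _; rewrite -natrM mulrA [_ * delta]mulrC.
  by rewrite ler_wpM2r.
have : 0 <= delta * S%:R :> R by rewrite mulr_ge0 // ltW.
rewrite natrM in delA *; lra.
Qed.
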